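(* Let $R$ be a unital ring with involution and let $a\in R$. Then the following are equivalent: (1) $a$ is an EP element; (2) $a$ is core invertible and $aR\subseteq a^*R$; (3) $a$ is core invertible and $Ra\subseteq Ra^*$; (4) $a$ is core invertible and $a^*R\subseteq aR$; (5) $a$ is core invertible and $Ra^*\subseteq Ra$.
   Context: A unital (associative, not necessarily commutative) ring with involution is a unital ring $R$ with a map $a\mapsto a^*$ satisfying $(a^* )^*=a$, $(ab)^*=b^*a^*$, $(a+b)^*=a^*+b^*$ for all $a,b\in R$. Notation: $aR=\{ar:r\in R\}$, $Ra=\{ra:r\in R\}$. The Moore-Penrose inverse of $a\in R$ is the element $a^\dagger=x$ (unique if it exists) with $axa=a$, $xax=x$, $(ax)^*=ax$, $(xa)^*=xa$; the group inverse of $a$ is the element $a^\#=x$ (unique if it exists) with $axa=a$, $xax=x$, $ax=xa$. An element $a\in R$ is EP if it is both Moore-Penrose invertible and group invertible and $a^\dagger=a^\#$. An element $a\in R$ is core invertible if there is $x\in R$ (necessarily unique, called the core inverse of $a$) with $axa=a$, $xR=aR$ and $Rx=Ra^*$. *)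

(* Defs.v *)
From mathcomp Require Import all_boot all_algebra.
From mathcomp Require Import boolp classical_sets.

Set Implicit Arguments.
Unset Strict Implicit.
Unset Printing Implicit Defensive.

Import GRing.Theory.
Local Open Scope classical_set_scope.
Local Open Scope ring_scope.

(* [pzRingType] allows 1 = 0: the zero ring counts as a unital ring. *)
Record ring_involution (R : pzRingType) (star : R -> R) : Prop :=
  RingInvolution {
    starK : forall a, star (star a) = a;
    starM : forall a b, star (a * b) = star b * star a;
    starD : forall a b, star (a + b) = star a + star b
  }.

Definition right_ideal (R : pzRingType) (a : R) : set R :=
  [set a * r | r in [set: R]].

Definition left_ideal (R : pzRingType) (a : R) : set R :=
  [set r * a | r in [set: R]].

Definition is_MP_inverse (R : pzRingType) (star : R -> R) (a x : R) : Prop :=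
  [/\ a * x * a = a, x * a * x = x,
      star (a * x) = a * x & star (x * a) = x * a].

Definition is_group_inverse (R : pzRingType) (a x : R) : Prop :=
  [/\ a * x * a = a, x * a * x = x & a * x = x * a].

Definition is_core_inverse (R : pzRingType) (star : R -> R) (a x : R) : Prop :=
  [/\ a * x * a = a, right_ideal x = right_ideal a
    & left_ideal x = left_ideal (star a)].

Definition core_invertible (R : pzRingType) (star : R -> R) (a : R) : Prop :=
  exists x, is_core_inverse star a x.

Definition EP (R : pzRingType) (star : R -> R) (a : R) : Prop :=
  exists x y, [/\ is_MP_inverse star a x, is_group_inverse a y & x = y].

(* By the next two lemmas, the witnesses in [EP] are the Moore-Penrose and
   group inverses of [a]. *)
Lemma MP_inverse_uniq (R : pzRingType) (star : R -> R) (a x y : R) :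
  ring_involution star ->
  is_MP_inverse star a x -> is_MP_inverse star a y -> x = y.
Proof.
move=> invS [axa xax sax sxa] [aya yay say sya].
have eq_ax : a * x = a * y.
  by rewrite -sax -[in LHS]aya -(mulrA (a * y)) (starM invS) sax say mulrA axa.
have eq_xa : x * a = y * a.
  rewrite -sxa -[in LHS]aya -(mulrA a) mulrA (starM invS) sxa sya.
  by rewrite -mulrA (mulrA a) axa.
by rewrite -xax -mulrA eq_ax mulrA eq_xa yay.
Qed.

Lemma group_inverse_uniq (R : pzRingType) (a x y : R) :
  is_group_inverse a x -> is_group_inverse a y -> x = y.
Proof.
move=> [axa xax cx] [aya yay cy].
have eq_xa : x * a = y * a.
  by rewrite -[in LHS]aya -(mulrA a) -cy !mulrA -cx axa cy.
by rewrite -xax -mulrA cx eq_xa -cy mulrA eq_xa yay.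
Qed.

(* Main.v *)
Require Import Defs.
From mathcomp Require Import all_boot all_algebra.
From mathcomp Require Import boolp classical_sets.

(** Let [x] be a core inverse of [a].  Then [p = a * x] is a self-adjoint
    idempotent and [e = x * a] an idempotent with the same range [aR], and [a]
    is EP as soon as [e = p], because [x] is then both the Moore-Penrose and
    the group inverse of [a].  Two of the four inclusions give this equality
    directly.
    - If [Ra] is contained in [Ra*], then [a * p = a], since [star a * p = star a];
      hence [e = e * p = x * a * a * x = p].
    - If [aR] is contained in [a*R], then [star e * a = a], since [star e * star a = star a];
      hence [star e * e = e], so [e] is self-adjoint, and self-adjoint idempotents
      with the same range are equal.
    The involution exchanges left and right ideals, which turns the other two
    inclusions into these.  Conversely, for an EP element the common inverse
    is a core inverse, and [a * x = x * a] being self-adjoint yields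
    [aR = a*R] and [Ra = Ra*]. *)

Import GRing.Theory.
Local Open Scope classical_set_scope.
Local Open Scope ring_scope.

Lemma right_ideal_subP (R : pzRingType) (a b : R) :
  right_ideal a `<=` right_ideal b <-> exists r, a = b * r.
Proof.
split=> [sab | [r ->] _ [s _ <-]]; last by exists (r * s); rewrite ?mulrA.
have /sab[r _ <-] : right_ideal a a by exists 1; rewrite ?mulr1.
by exists r.
Qed.

Lemma left_ideal_subP (R : pzRingType) (a b : R) :
  left_ideal a `<=` left_ideal b <-> exists r, a = r * b.
Proof.
split=> [sab | [r ->] _ [s _ <-]]; last by exists (s * r); rewrite ?mulrA.
have /sab[r _ <-] : left_ideal a a by exists 1; rewrite ?mul1r.
by exists r.
Qed.

Lemma star_right_left (R : pzRingType) (star : R -> R) (a b : R) :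
  ring_involution star ->
  right_ideal a `<=` right_ideal b ->
  left_ideal (star a) `<=` left_ideal (star b).
Proof.
move=> inv /right_ideal_subP[r ->]; apply/left_ideal_subP.
by exists (star r); rewrite (starM inv).
Qed.

Lemma star_left_right (R : pzRingType) (star : R -> R) (a b : R) :
  ring_involution star ->
  left_ideal a `<=` left_ideal b ->
  right_ideal (star a) `<=` right_ideal (star b).
Proof.
move=> inv /left_ideal_subP[r ->]; apply/right_ideal_subP.
by exists (star r); rewrite (starM inv).
Qed.

(** The equational form of core invertibility.  Writing [x = u * star a] gives
    [x = x * star (a * x)], so [a * x = (a * x) * star (a * x)] is self-adjoint;
    the last two equations hold because the idempotents [x * a] and [a * x]
    both fix [xR = aR] pointwise. *)
Lemma core_inverse_eqs (R : pzRingType) (star : R -> R) (a x : R) :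
  ring_involution star -> is_core_inverse star a x ->
  [/\ x * a * x = x, star (a * x) = a * x, x * a * a = a & a * x * x = x].
Proof.
move=> inv [axa eqR eqL].
have [u xu] : exists u, x = u * star a.
  by apply/left_ideal_subP; rewrite eqL.
have [s as_] : exists s, a = x * s.
  by apply/right_ideal_subP; rewrite eqR.
have [t xt] : exists t, x = a * t.
  by apply/right_ideal_subP; rewrite eqR.
have xp : x * star (a * x) = x.
  by rewrite [X in X * star _]xu -mulrA -(starM inv) axa -xu.
have sp : star (a * x) = a * x.
  have pp : a * x * star (a * x) = a * x by rewrite -mulrA xp.
  by rewrite -[in LHS]pp (starM inv) (starK inv) pp.
have xax : x * a * x = x by rewrite -mulrA -[in LHS]sp xp.
split=> //; first by rewrite [X in x * a * X]as_ mulrA xax -as_.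
by rewrite [X in a * x * X]xt mulrA axa -xt.
Qed.

Lemma core_inverse_comm_EP (R : pzRingType) (star : R -> R) (a x : R) :
  ring_involution star -> is_core_inverse star a x -> a * x = x * a ->
  EP star a.
Proof.
move=> inv core_x cx; have [axa _ _] := core_x.
have [xax sp _ _] := core_inverse_eqs _ _ _ _ inv core_x.
by exists x, x; split; split=> //; rewrite -cx.
Qed.

Lemma core_left_sub_EP (R : pzRingType) (star : R -> R) (a : R) :
  ring_involution star -> core_invertible star a ->
  left_ideal a `<=` left_ideal (star a) -> EP star a.
Proof.
move=> inv [x core_x] /left_ideal_subP[s as_].
apply: (core_inverse_comm_EP _ _ _ x inv core_x).
have [axa _ _] := core_x.
have [_ sp xaa _] := core_inverse_eqs _ _ _ _ inv core_x.
have sap : star a * (a * x) = star a by rewrite -sp -(starM inv) axa.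
have ap : a * (a * x) = a by rewrite [X in X * (a * x)]as_ -mulrA sap -as_.
by rewrite -[in RHS]ap !mulrA xaa.
Qed.

Lemma core_right_sub_EP (R : pzRingType) (star : R -> R) (a : R) :
  ring_involution star -> core_invertible star a ->
  right_ideal a `<=` right_ideal (star a) -> EP star a.
Proof.
move=> inv [x core_x] /right_ideal_subP[s as_].
apply: (core_inverse_comm_EP _ _ _ x inv core_x).
have [axa _ _] := core_x.
have [_ sp xaa axx] := core_inverse_eqs _ _ _ _ inv core_x.
have ea : star (x * a) * a = a.
  by rewrite [X in _ * X]as_ mulrA -(starM inv) mulrA axa -as_.
(* [x] lies in [aR], where [star (x * a)] acts as the identity. *)
have ex : star (x * a) * x = x by rewrite -[X in _ * X = _]axx !mulrA ea axx.
have se : star (x * a) = x * a.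
  have ee : star (x * a) * (x * a) = x * a by rewrite mulrA ex.
  by rewrite -[in LHS]ee (starM inv) (starK inv) ee.
have ep : (x * a) * (a * x) = a * x by rewrite mulrA xaa.
by rewrite -sp -[in LHS]ep (starM inv) sp se mulrA axx.
Qed.

Lemma EP_core_invertible (R : pzRingType) (star : R -> R) (a : R) :
  ring_involution star -> EP star a -> core_invertible star a.
Proof.
move=> inv [x [y [[axa xax sp _] [_ _ cx] xy]]]; subst y.
exists x; split=> //; rewrite eqEsubset; split.
- by apply/right_ideal_subP; exists (x * x); rewrite mulrA cx xax.
- by apply/right_ideal_subP; exists (a * a); rewrite mulrA -cx axa.
- apply/left_ideal_subP; exists (x * star x).
  by rewrite -mulrA -(starM inv) sp mulrA xax.
- apply/left_ideal_subP; exists (star a * a).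
  by rewrite -mulrA -[in RHS]sp -(starM inv) axa.
Qed.

Lemma EP_right_ideal_sub (R : pzRingType) (star : R -> R) (a : R) :
  ring_involution star -> EP star a ->
  right_ideal a `<=` right_ideal (star a).
Proof.
move=> inv [x [y [[axa _ _ se] [_ _ cx] xy]]]; subst y.
apply/right_ideal_subP; exists (star x * a).
by rewrite mulrA -(starM inv) se -cx axa.
Qed.

Lemma EP_left_ideal_sub (R : pzRingType) (star : R -> R) (a : R) :
  ring_involution star -> EP star a ->
  left_ideal a `<=` left_ideal (star a).
Proof.
move=> inv [x [y [[axa _ sp _] [_ _ cx] xy]]]; subst y.
apply/left_ideal_subP; exists (a * star x).
by rewrite -mulrA -(starM inv) sp cx mulrA axa.
Qed.

Theorem corollary3p10 (R : pzRingType) (star : R -> R)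
    (star_inv : ring_involution star) (a : R) :
  [<-> EP star a;
       core_invertible star a /\ right_ideal a `<=` right_ideal (star a);
       core_invertible star a /\ left_ideal a `<=` left_ideal (star a);
       core_invertible star a /\ right_ideal (star a) `<=` right_ideal a;
       core_invertible star a /\ left_ideal (star a) `<=` left_ideal a].
Proof.
have inv := star_inv.
tfae.
- by move=> ep; split; [apply: EP_core_invertible | apply: EP_right_ideal_sub].
- move=> [core sub]; split=> //.
  by apply: EP_left_ideal_sub => //; apply: core_right_sub_EP.
- move=> [core /(star_left_right _ _ _ _ inv) sub]; split=> //.
  by rewrite (starK inv) in sub.
- move=> [core /(star_right_left _ _ _ _ inv) sub]; split=> //.
  rewrite (starK inv) in sub.
  have ep : EP star a by apply: core_left_sub_EP.
  rewrite -[X in _ `<=` left_ideal X](starK inv).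
  by apply: star_right_left => //; apply: EP_right_ideal_sub.
- move=> [core /(star_left_right _ _ _ _ inv) sub].
  by rewrite (starK inv) in sub; apply: core_right_sub_EP.
Qed.
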